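(* (In $\mathsf{ZFC}$.) There exist two Hausdorff countably compact topological groups $\mathbb{G}_0$ and $\mathbb{G}_1$ such that the product $\mathbb{G}_0\times\mathbb{G}_1$ (with the product topology) is not countably compact.
   Context: An infinite topological space $X$ is countably compact if every infinite subset of $X$ has an accumulation point in $X$. *)

(* Defs.v *)
From HB Require Import structures.
From mathcomp Require Import all_boot.
From mathcomp Require Import boolp classical_sets functions cardinality.
From mathcomp Require Import topology.

Set Implicit Arguments.
Unset Strict Implicit.
Unset Printing Implicit Defensive.

Local Open Scope classical_set_scope.

HB.structure Definition PreTopologicalGroup :=
  {G of Topological G & Group G}.

HB.mixin Record PreTopologicalGroup_isTopologicalGroup G
    & PreTopologicalGroup G := {
  mulg_continuous : continuous (fun x : G * G => (x.1 * x.2)%g) ;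
  invg_continuous : continuous (fun x : G => (x^-1)%g) }.

(* The Hausdorff property is not part of the structure. *)
#[short(type="topologicalGroupType")]
HB.structure Definition TopologicalGroup :=
  {G of PreTopologicalGroup G & PreTopologicalGroup_isTopologicalGroup G}.

(* This notion is meant for infinite spaces only: it holds vacuously for every
   finite space, so infiniteness has to be required separately. *)
Definition countably_compact (X : topologicalType) : Prop :=
  forall A : set X, infinite_set A -> exists x : X, limit_point A x.

(* Main.v *)
Require Import Defs.
From HB Require Import structures.
From mathcomp Require Import all_boot all_algebra.
From mathcomp Require Import boolp classical_sets functions cardinality.
From mathcomp Require Import filter topology.

Set Implicit Arguments.
Unset Strict Implicit.
Unset Printing Implicit Defensive.

Import GRing.Theory.
Local Open Scope ring_scope.
Local Open Scope classical_set_scope.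

(** Both groups are subgroups of the compact Boolean group [(tree -> bool) -> bool],
    and they meet in the group spanned by countably many independent elements
    [e_n] (the leaves).  The diagonal of the intersection of two subgroups of a
    Hausdorff group is closed in their product, so the points [(e_n, e_n)] could
    accumulate only at some [(x, x)] with [x] in that span; but [x] involves
    finitely many of the [e_n], and the characters of the span, which are
    arbitrary on the [e_n], then isolate [x] from the other [e_n].

    Each group is made countably compact by adding limits.  A [tree] is either a
    leaf or a node that carries a sequence of finite sets of trees; the node
    stands for a limit of the corresponding sequence of finite sums, along an
    ultrafilter attached to the node.  An assignment of bits to the leaves (and
    to the nodes whose sequence is not linearly independent) then extends by
    recursion to a bit [value phi k] for every tree [k], and a finite set of
    trees becomes a function of [phi].  Every infinite subset of a Boolean group
    contains a linearly independent sequence, so some node is an accumulation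
    point of it.  Nodes carry one of two colours, and the two groups are spanned
    by the trees all of whose nodes have the same colour; only leaves belong to
    both.

    What must be shown is that the limits create no relations: a nonzero formal
    sum [a] of trees has a nonzero value for some [phi] (lemma [separation]).
    Only the countably many subtrees of [a] matter.  One needs, for each node [k]
    among them whose sequence of sums [f_k] is independent, a set [U] in the
    ultrafilter of [k] such that the elements [k + f_k(j)], for [j] in [U], together
    with those of the other nodes, do not span [a]; a character that kills these
    elements and not [a] then supplies [phi].  For this the natural numbers are cut
    into blocks, each very long compared with the total length of its
    predecessors.  An almost disjoint family gives every tree its own infinite set
    of blocks, two trees sharing only finitely many, and the ultrafilter of
    [k] contains every set that misses few points of each block of [k]
    ([ultrafilter_of_slack]).  Assigning each block to at most one of countably
    many nodes ([exists_owner]) and keeping those [j] whose element is not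
    spanned by [a] and the earlier elements discards few points of every block
    assigned to such a node ([count_stale]). *)

(** * Linear algebra over the field with two elements *)

Definition boolean (V : zmodType) := forall x : V, x + x = 0.

Lemma boolean_fun (T : Type) : boolean (T -> bool).
Proof. by move=> f; apply/funext => t; exact: addbb. Qed.

Section BooleanGroup.
Context {V : zmodType} (V2 : boolean V).
Implicit Types (a x y : V) (g : nat -> V) (c d : nat -> bool) (N n m : nat).

Lemma boolean_addK x y : x + y + y = x.
Proof. by rewrite -addrA V2 addr0. Qed.

Lemma boolean_eq x y : (x + y = 0) <-> (x = y).
Proof.
by split=> [h | ->]; [rewrite -[LHS](boolean_addK x y) h add0r | exact: V2].
Qed.

Lemma boolean_mulrb x (b1 b2 : bool) : x *+ b1 + x *+ b2 = x *+ (b1 (+) b2).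
Proof. by case: b1 b2 => -[]; rewrite ?mulr0n ?mulr1n ?add0r ?addr0 ?V2. Qed.

Lemma boolean_mulrn x n : x *+ n = x *+ odd n.
Proof.
elim: n => // n IH; rewrite mulrSr IH -[X in _ + X]mulr1n.
by rewrite (boolean_mulrb x _ true) addbT.
Qed.

(** A finite subset of the indices is a bound [N] together with an indicator [c];
    the symmetric difference of two subsets is then [addb], pointwise. *)
Definition subsum g N c : V := \sum_(i < N) g i *+ c i.

Lemma subsumS g N c : subsum g N.+1 c = subsum g N c + g N *+ c N.
Proof. by rewrite /subsum big_ord_recr. Qed.

Lemma subsumD g N c d : subsum g N c + subsum g N d = subsum g N (fun i => c i (+) d i).
Proof. by rewrite /subsum -big_split; apply: eq_bigr => i _; exact: boolean_mulrb. Qed.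

Lemma subsum_widen g n N c : (n <= N)%N -> subsum g n c = subsum g N (fun i => (i < n)%N && c i).
Proof.
move=> /subnK <-; elim: (N - n)%N => [|k IH] /=.
  by apply: eq_bigr => i _; rewrite ltn_ord.
by rewrite addSn subsumS -IH ltnNge leq_addl mulr0n addr0.
Qed.

Lemma subsum_single g n N : (n < N)%N -> subsum g N (fun i => i == n) = g n.
Proof.
move=> nN; rewrite /subsum (bigD1 (Ordinal nN)) //= eqxx mulr1n big1 ?addr0 // => i.
by rewrite -val_eqE /= => /negPf ->.
Qed.

Definition independent g (I : set nat) := forall N c,
  (forall i, c i -> I i) -> subsum g N c = 0 -> forall i, (i < N)%N -> c i = false.

Lemma independent_greedy g :
  (forall n c, g n <> subsum g n c) -> independent g setT.
Proof.
move=> gn N c _; elim: N => // N IH; rewrite subsumS.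
case cN: (c N); rewrite ?mulr1n ?mulr0n ?addr0.
  by move=> /boolean_eq e; case: (gn N c).
by move=> e i; rewrite ltnS leq_eqVlt => /predU1P[-> //|]; exact: IH.
Qed.

Lemma independent_inj g : independent g setT -> injective g.
Proof.
move=> gI n m gnm; apply/eqP; apply: contraT => nm.
have := gI (maxn n m).+1 (fun i => (i == n) (+) (i == m)) (fun=> fun=> I).
rewrite -subsumD !subsum_single ?ltnS ?leq_maxl ?leq_maxr // gnm V2 => /(_ erefl n).
by rewrite eqxx (negPf nm) ltnS leq_maxl => /(_ isT).
Qed.

(** A finite set spans only finitely many elements, so a further element of [X]
    outside the span of those already chosen always exists. *)
Lemma infinite_independent (X : set V) : infinite_set X ->
  exists2 x : nat -> V, forall n, X (x n) & independent x setT.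
Proof.
move=> Xinf.
have step (s : seq V) : exists y, X y /\ forall c, y <> subsum (nth 0 s) (size s) c.
  pose F (f : {ffun 'I_(size s) -> bool}) := \sum_(i < size s) nth 0 s i *+ f i.
  have Ffin : finite_set (range F) by exact: finite_image.
  have [y [Xy yF]] : (X `\` range F) !=set0.
    by apply: infinite_setN0; exact: infinite_setD.
  exists y; split=> // c yc; apply: yF; exists [ffun i => c (val i)] => //.
  by rewrite yc; apply: eq_bigr => i _; rewrite ffunE.
have [F FP] := boolp.choice step.
pose fix ch n := if n is n'.+1 then rcons (ch n') (F (ch n')) else [::].
pose x n := F (ch n).
have chE n : ch n = mkseq x n.
  by elim: n => //= n IH; rewrite mkseqS -[in RHS]IH.
exists x => [n|]; first by case: (FP (ch n)).
apply: independent_greedy => n c xn.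
have [_ /(_ c)] := FP (ch n); apply; rewrite -/(x n) xn chE size_mkseq.
by apply: eq_bigr => i _; rewrite nth_mkseq.
Qed.

(** Comparing [g j] with all earlier terms, whether or not they are themselves
    fresh, gives the same span and needs no recursion. *)
Definition fresh a g j := `[< ~ exists c (e : bool), g j = subsum g j c + a *+ e >].

(** In a sum of fresh terms equal to [a], the last term would be spanned by [a] and
    its predecessors. *)
Lemma fresh_subsum a g N c : a <> 0 -> (forall i, c i -> fresh a g i) -> subsum g N c <> a.
Proof.
move=> a0 cf; elim: N => [|N IH]; first by rewrite /subsum big_ord0 => /esym.
rewrite subsumS; case cN: (c N); last by rewrite mulr0n addr0.
move=> e; have /asboolP := cf _ cN; apply; exists c, true.
by rewrite -e mulr1n addrA V2 add0r.
Qed.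

(** Write each stale term of the interval as a combination of [a], of the terms
    before [m] and of the earlier terms of the interval.  Two stale terms with the
    same part in [a] and the terms before [m] would give a relation within the
    interval, so the stale terms are at most as many as those parts: [2 ^ m]
    subsets, with or without [a]. *)
Lemma count_stale a g m M : independent g [set i | (m <= i < M)%N] ->
  (count (fun i => ~~ fresh a g i) (index_iota m M) <= 2 ^ m.+1)%N.
Proof.
move=> gI; rewrite -size_filter; set R := [seq i <- _ | _].
have step (k : nat) : exists ce : (nat -> bool) * bool,
    k \in R -> g k = subsum g k ce.1 + a *+ ce.2.
  have [|_] := boolP (k \in R); last by exists (xpred0, true).
  rewrite mem_filter => /andP[/asboolPn/contrapT[c [e ke]] _].
  by exists (c, e).
have [ce ceP] := boolp.choice step.
pose c k := (ce k).1; pose e k := (ce k).2.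
pose w k : {ffun 'I_m -> bool} * bool := ([ffun i : 'I_m => c k i], e k).
pose d k i := (i == k) (+) ((i < k)%N && c k i).
have dE k : k \in R -> subsum g M (d k) = a *+ e k.
  move=> kR; have kM : (k < M)%N.
    by move: kR; rewrite mem_filter mem_index_iota => /and3P[].
  by rewrite -subsumD subsum_single // -subsum_widen 1?ltnW// {1}(ceP _ kR) addrAC V2 add0r.
have winj : {in R &, injective w}.
  have main k k' : k \in R -> k' \in R -> (k < k')%N -> w k <> w k'.
    move=> kR k'R kk' [/ffunP ec ee].
    have := kR; have := k'R; rewrite !mem_filter !mem_index_iota.
    move=> /and3P[_ mk' k'M] /and3P[_ mk kM].
    have supp i : d k i (+) d k' i -> (m <= i < M)%N.
      have [im|mi] := ltnP i m.
        have := ec (Ordinal im); rewrite !ffunE /d /= => ->.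
        by rewrite !ltn_eqF ?(leq_trans im) // addbb.
      apply: contraTT; rewrite /= -leqNgt /d => Mi.
      by rewrite !gtn_eqF ?(leq_trans _ Mi)// !ltnNge !(leq_trans (ltnW _) Mi).
    have := gI M (fun i => d k i (+) d k' i) supp.
    rewrite -subsumD !dE // ee V2 => /(_ erefl _ k'M); rewrite /d eqxx ltnn /=.
    by rewrite gtn_eqF // (ltnNge k') (ltnW kk').
  move=> k k' kR k'R wkk'; case: (ltngtP k k') => // h.
    by case: (main _ _ kR k'R h).
  by case: (main _ _ k'R kR h).
have Runiq : uniq R by rewrite filter_uniq // iota_uniq.
rewrite -(size_map w) -(card_uniqP _); last by rewrite map_inj_in_uniq.
by rewrite (leq_trans (max_card _)) // card_prod card_ffun card_bool card_ord expnSr.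
Qed.

(** A subgroup that contains [H] and is maximal for omitting [a] has index 2: if it
    omits [x], it contains [x + a].  Its complement is the character sought. *)
Lemma character_extension (H : set V) a :
  H 0 -> (forall x y, H x -> H y -> H (x + y)) -> ~ H a ->
  exists psi : V -> bool, [/\ forall x y, psi (x + y) = psi x + psi y,
    forall h, H h -> psi h = false & psi a].
Proof.
move=> H0 HD Ha.
(* The empty set is let in as the union of the empty chain. *)
pose P (M : set V) := M !=set0 ->
  [/\ H `<=` M, forall x y, M x -> M y -> M (x + y) & ~ M a].
have [M [PM Mmax]] : exists M, P M /\ forall B, M `<` B -> ~ P B.
  apply: Zorn_bigcup => F FP Ftot [x [A FA Ax]].
  have FPA B y : F B -> B y -> [/\ H `<=` B, forall x y, B x -> B y -> B (x + y) & ~ B a].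
    by move=> FB By; apply: FP => //; exists y.
  split=> [h Hh | y z [B FB By] [C FC Cz] | [B FB Ba]].
  - by exists A => //; have [+ _ _] := FPA _ _ FA Ax; apply.
  - have [BC|CB] := Ftot _ _ FB FC.
      by exists C => //; have [_ + _] := FPA _ _ FC Cz; apply=> //; exact: BC.
    by exists B => //; have [_ + _] := FPA _ _ FB By; apply=> //; exact: CB.
  - by have [_ _] := FPA _ _ FB Ba.
have M0 : M !=set0.
  have [//|M0] := pselect (M !=set0); exfalso.
  apply: (Mmax H); last by move=> _; split.
  split=> [x Mx|HM]; first by case: M0; exists x.
  by case: M0; exists 0; exact: HM.
have {PM} [HM MD Ma] := PM M0.
have Mx x : ~ M x -> M (x + a).
  move=> nMx; apply: contrapT => nMxa.
  apply: (Mmax [set y | M y \/ M (y + x)]).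
    split=> [y My|]; first by left.
    move=> /(_ x) /=; rewrite V2 => sub; apply: nMx; apply: sub; right; exact: HM.
  move=> _; split=> [h Hh|y z|].
  - by left; exact: HM.
  - move=> /= -[My|My] [Mz|Mz].
    + by left; exact: MD.
    + by right; rewrite -addrA; exact: MD.
    + by right; rewrite addrAC; exact: MD.
    + by left; rewrite -(boolean_addK (y + z) x) -addrA addrACA; exact: MD.
  - by move=> /= [//|]; rewrite addrC.
have MB x y : M x -> M (x + y) -> M y.
  by move=> Mx' /(MD _ _ Mx'); rewrite addrA V2 add0r.
exists (fun x => ~~ `[< M x >]); split=> [x y|h Hh|]; last 2 first.
- by apply/negbTE/negPn/asboolP/HM.
- by apply/asboolPn.
have -> (b1 b2 : bool) : b1 + b2 = b1 (+) b2 by [].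
case: (asboolP (M x)) => hx; case: (asboolP (M y)) => hy /=.
- by apply/negbTE/negPn/asboolP/MD.
- by apply/asboolPn => /(MB _ _ hx).
- by apply/asboolPn; rewrite addrC => /(MB _ _ hy).
- apply/negbTE/negPn/asboolP.
  by have := MD _ _ (Mx _ hx) (Mx _ hy); rewrite addrACA V2 addr0.
Qed.

Lemma character_of_fresh a g : a <> 0 ->
  exists psi : V -> bool, [/\ forall x y, psi (x + y) = psi x + psi y,
    forall j, fresh a g j -> psi (g j) = false & psi a].
Proof.
move=> a0.
pose H := [set x | exists N c, (forall i, c i -> fresh a g i) /\ x = subsum g N c].
have [|x y [N [c [cf ->]]] [N' [c' [c'f ->]]]|[N [c [cf]]]|psi [psiD psiH psia]]
    := @character_extension H a.
- by exists 0%N, xpred0; split=> //; rewrite /subsum big_ord0.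
- exists (maxn N N'), (fun i => ((i < N)%N && c i) (+) ((i < N')%N && c' i)).
  split; last by rewrite -subsumD -!subsum_widen ?leq_maxl ?leq_maxr.
  by move=> i; case ci: (c i); case c'i: (c' i); rewrite ?andbF //= => _; auto.
- by move/esym; exact: fresh_subsum.
exists psi; split=> // j fj; apply: psiH.
exists j.+1, (fun i => i == j); split; last by rewrite subsum_single.
by move=> i /eqP ->.
Qed.

End BooleanGroup.

(** * Blocks of natural numbers and their ultrafilters *)

(** The block of index [n] is the interval from [start n] to [start n.+1].  Its
    length is [n.+1] times the number [slack n] of points that [count_stale] may
    discard from it. *)
Fixpoint start n := if n is n'.+1 then (start n' + n * 2 ^ (start n').+1)%N else 0%N.

Definition slack n := (2 ^ (start n).+1)%N.

Lemma startS n : start n.+1 = (start n + n.+1 * slack n)%N. Proof. by []. Qed.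

Lemma slack_gt0 n : (0 < slack n)%N. Proof. by rewrite expn_gt0. Qed.

Lemma start_mono : {homo start : m n / (m <= n)%N}.
Proof. by apply: homo_leq => // [? ? ?|n]; [exact: leq_trans | exact: leq_addr]. Qed.

Lemma leq_start n : (n <= start n)%N.
Proof.
elim: n => // n IH; rewrite startS -addn1.
by rewrite leq_add // muln_gt0 addn1 slack_gt0.
Qed.

Fact lt_start j : exists n, (j < start n.+1)%N.
Proof. by exists j; exact: leq_start. Qed.

Definition block_of j := ex_minn (lt_start j).

Lemma block_ofE n j : (start n <= j < start n.+1)%N -> block_of j = n.
Proof.
move=> /andP[nj jn]; rewrite /block_of; case: ex_minnP => m jm mmin.
apply/eqP; rewrite eqn_leq mmin //= leqNgt; apply/negP => mn.
by have := leq_trans jm (leq_trans (start_mono mn) nj); rewrite ltnn.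
Qed.

Definition missed (U : set nat) n :=
  count (fun j => ~~ `[< U j >]) (index_iota (start n) (start n.+1)).

(** The sets that miss at most a constant times [slack n] points of almost all the
    blocks [n] of [A] form a filter; it is proper because the lengths of the
    blocks outgrow every such bound. *)
Lemma ultrafilter_of_slack (A : set nat) :
  (forall N, exists n, (N <= n)%N /\ A n) ->
  exists p : set_system nat, UltraFilter p /\
    forall C N U, (forall n, (N <= n)%N -> A n -> (missed U n <= C * slack n)%N) -> p U.
Proof.
move=> Ainf.
pose F : set_system nat := [set U | exists C N,
  forall n, (N <= n)%N -> A n -> (missed U n <= C * slack n)%N].
have missedS (U W : set nat) n : U `<=` W -> (missed W n <= missed U n)%N.
  by move=> UW; apply: sub_count => j; apply: contra => /asboolP/UW/asboolP.
have : ProperFilter F.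
  constructor; last constructor.
  - move=> [C [N FN]]; have [n [Nn An]] := Ainf (maxn N C).
    have := FN n (leq_trans (leq_maxl _ _) Nn) An.
    rewrite /missed (@eq_count _ _ predT) => [|j]; last by apply/asboolPn.
    rewrite count_predT size_iota startS addKn leq_pmul2r ?slack_gt0 // leqNgt.
    by rewrite ltnS (leq_trans (leq_maxr _ _) Nn).
  - exists 0%N, 0%N => n _ _; rewrite /missed (@eq_count _ _ pred0) ?count_pred0 // => j.
    by apply/negbTE/negPn/asboolP.
  - move=> U W [C [N UN]] [C' [N' WN]]; exists (C + C')%N, (maxn N N') => n.
    rewrite geq_max => /andP[Nn N'n] An; rewrite mulnDl.
    apply: leq_trans (leq_add (UN n Nn An) (WN n N'n An)).
    rewrite -count_predUI (leq_trans _ (leq_addr _ _)) //; apply: sub_count => j /=.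
    by rewrite -negb_and; apply: contra => /andP[/asboolP ? /asboolP ?]; apply/asboolP.
  - move=> U W UW [C [N UN]]; exists C, N => n Nn An.
    exact: leq_trans (missedS _ _ _ UW) (UN n Nn An).
move=> /ultraFilterLemma[p [pU Fp]]; exists p; split=> // C N U UN.
by apply: Fp; exists C, N.
Qed.

(** * Trees and an almost disjoint family indexed by them *)

(** [Node i l f] stands for a limit of the finite sums of [f n 0], ..., [f n (l n).-1]
    as [n] varies; [i] is its colour.  Having the sequence inside the limit point
    makes recursion on trees take the place of a transfinite construction. *)
Inductive tree := Leaf of nat | Node of bool & (nat -> nat) & (nat -> nat -> tree).

HB.instance Definition _ := gen_eqMixin tree.
HB.instance Definition _ := gen_choiceMixin tree.

(** The label of [k] at the address [s].  Addresses alternate an index of the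
    sequence with an index in the corresponding finite set; those of length 1 give
    the sizes.  The labels determine the tree, so there are at most continuum many
    trees. *)
Fixpoint label k (s : seq nat) : nat :=
  match k, s with
  | Leaf n, _ => n.+2
  | Node i _ _, [::] => i
  | Node _ l _, [:: n] => l n
  | Node _ _ f, n :: j :: s => label (f n j) s
  end.

Lemma label_inj : injective label.
Proof.
elim=> [n|i l f IH] [n'|i' l' f'] /(fun e s => congr1 (@^~ s) e) /= e.
- by have [->] := e [::].
- by have := e [::]; case: (i').
- by have := e [::]; case: (i).
- have -> : i = i' by have := e [::]; case: (i); case: (i').
  have -> : l = l' by apply/funext => n; exact: (e [:: n]).
  congr Node; apply/funext => n; apply/funext => j; apply: IH.
  by apply/funext => s; exact: (e [:: n, j & s]).
Qed.

(** The prefixes of the labelling of [k], in a fixed enumeration of the addresses: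
    distinct trees share only finitely many prefixes. *)
Definition label_prefix k m : nat :=
  pickle (mkseq (fun i => label k (odflt [::] (unpickle i))) m).

Definition spread k : set nat := range (label_prefix k).

Lemma label_prefix_inj k : injective (label_prefix k).
Proof. by move=> m m' /(pcan_inj pickleK)/(congr1 size); rewrite !size_mkseq. Qed.

Lemma spread_infinite k N : exists n, (N <= n)%N /\ spread k n.
Proof.
apply: contrapT => noN.
have : finite_set (label_prefix k @^-1` `I_N).
  by apply: finite_preimage => // ? ? _ _; exact: label_prefix_inj.
rewrite (_ : _ @^-1` _ = setT); first exact: infinite_nat.
apply/seteqP; split=> // m _; rewrite /= ltnNge; apply/negP => Nm.
by apply: noN; exists (label_prefix k m); split=> //; exists m.
Qed.

Lemma spread_disjoint k k' : k <> k' ->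
  exists N, forall n, (N <= n)%N -> spread k n -> ~ spread k' n.
Proof.
move=> kk'; have [s ss'] : exists s, label k s <> label k' s.
  apply: contrapT => no; apply/kk'/label_inj/funext => s.
  by apply: contrapT => ss'; apply: no; exists s.
exists (\max_(m < (pickle s).+1) label_prefix k m).+1 => n + [m _ mn] [m' _].
rewrite -mn => lt /(pcan_inj pickleK) e.
have mm' : m' = m by have := congr1 size e; rewrite !size_mkseq.
rewrite {m'}mm' in e; have [ms|sm] := ltnP m (pickle s).+1.
  have := leq_bigmax (F := fun m : 'I_(pickle s).+1 => label_prefix k m) (Ordinal ms).
  by rewrite leqNgt /= lt.
have := congr1 (nth 0%N ^~ (pickle s)) e.
by rewrite !nth_mkseq // pickleK /= => /esym.
Qed.

(** The block [n] goes to the first tree [d i], with [i < n], whose family member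
    contains [n], and to [d n] if there is none.  A tree [d i] loses only finitely many of its blocks to the
    finitely many trees enumerated before it. *)
Lemma exists_owner (d : nat -> tree) : exists own : nat -> tree,
  forall k, range d k -> exists N, forall n, (N <= n)%N -> spread k n -> own n = k.
Proof.
pose hit n i := `[< spread (d i) n >].
exists (fun n => d (find (hit n) (iota 0 n))) => k [i _ <-].
have [N NP] : exists N, forall n j, (N <= n)%N -> (j < i)%N ->
    spread (d i) n -> spread (d j) n -> d j = d i.
  move: (d i) => {}k; elim: i => [|m [N NP]]; first by exists 0%N.
  have [ekm|/spread_disjoint[N' N'P]] := EM (k = d m).
    exists N => n j Nn; rewrite ltnS leq_eqVlt => /predU1P[-> //|]; exact: NP.
  exists (maxn N N') => n j; rewrite geq_max => /andP[Nn N'n].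
  rewrite ltnS leq_eqVlt => /predU1P[-> kn /(N'P n N'n kn)//|]; exact: NP.
exists (maxn N i.+1) => n; rewrite geq_max => /andP[Nn ni] din.
have hasn : has (hit n) (iota 0 n).
  by apply/hasP; exists i; [rewrite mem_iota | apply/asboolP].
have := nth_find 0%N hasn; set j := find _ _ => hj.
have jn : (j < n)%N by move: hasn; rewrite has_find size_iota.
have [ij|ji|<- //] := ltngtP i j.
  have := before_find 0%N ij; rewrite nth_iota ?(ltn_trans ij) // add0n.
  by move/asboolP.
by apply: (NP n) => //; move: hj; rewrite nth_iota // => /asboolP.
Qed.

(** * Limits and the separation of formal sums *)

Definition unit_vector k : tree -> bool := eq_op^~ k.

Definition formal (s : seq tree) : tree -> bool := \sum_(k <- s) unit_vector k.

Lemma formalE s k : formal s k = odd (count_mem k s).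
Proof.
rewrite /formal; elim: s => [|j s IH]; first by rewrite big_nil.
rewrite big_cons [LHS]/(_ (+) _) IH /= oddD /unit_vector eq_sym.
by case: (j == k).
Qed.

Lemma sum_formal (V : zmodType) (y : tree -> V) s :
  boolean V -> formal s = 0 -> \sum_(k <- s) y k = 0.
Proof.
move=> V2 s0; rewrite -big_undup_iterop_count big1 // => k _.
have : odd (count_mem k s) = false by rewrite -formalE s0.
by move=> /negbT; rewrite -[iterop _ _ _ _]/(y k *+ _) boolean_mulrn // => /negPf ->.
Qed.

Definition terms (l : nat -> nat) (f : nat -> nat -> tree) n := mkseq (f n) (l n).

Lemma big_terms (V : zmodType) (y : tree -> V) l f n :
  \sum_(k <- terms l f n) y k = \sum_(j < l n) y (f n j).
Proof. by rewrite /terms /mkseq big_map -[l n in LHS]subn0 -/(index_iota 0 (l n)) big_mkord. Qed.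

(** Limits are imposed only along linearly independent sequences: any other
    sequence might force a relation, for instance between its own terms. *)
Definition admissible l f := `[< independent (fun n => formal (terms l f n)) setT >].

Definition ultra k := projT1 (cid (ultrafilter_of_slack (spread_infinite k))).

Instance ultra_ultra k : UltraFilter (ultra k).
Proof. by rewrite /ultra; case: cid => p []. Qed.

Lemma ultra_slack k C N U :
  (forall n, (N <= n)%N -> spread k n -> (missed U n <= C * slack n)%N) -> ultra k U.
Proof. by rewrite /ultra; case: cid => p [_ /= h]; exact: h. Qed.

Lemma ultra_cofinite k M : ultra k [set n | (M <= n)%N].
Proof.
apply: (@ultra_slack k 0 M) => n Mn _; rewrite leqn0 /missed -leqn0 leqNgt -has_count.
apply/hasPn => j; rewrite mem_index_iota => /andP[nj _]; apply/negPn/asboolP => /=.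
exact: leq_trans Mn (leq_trans (leq_start n) nj).
Qed.

(** At an admissible node this is the limit of the values of the sums along the
    ultrafilter of the node, which is 1 when the sums have value 1 on a set of the
    ultrafilter.  At the other nodes [phi] is free, as it is on the leaves. *)
Fixpoint value (phi : tree -> bool) k : bool :=
  match k with
  | Leaf _ => phi k
  | Node i l f =>
    if admissible l f
    then `[< ultra k [set n | \sum_(j < l n) value phi (f n j)] >] else phi k
  end.

Lemma value_limit phi i l f (k := Node i l f) : admissible l f ->
  ultra k [set n | \sum_(k' <- terms l f n) value phi k' = value phi k].
Proof.
move=> adm; rewrite {2}/k /= adm; set A := [set n | is_true _].
case: asboolP => h; [apply: filterS h|] => [n An|]; first by rewrite /= big_terms.
have [//|] := in_ultra_setVsetC A (ultra_ultra k).
by apply: filterS => n /= nA; rewrite big_terms; apply/negbTE/negP.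
Qed.

Lemma ultra_limit_unique k (U : set nat) (v : nat -> bool) b : ultra k U ->
  (forall n, U n -> v n = b) -> `[< ultra k [set n | v n] >] = b.
Proof.
move=> kU vb; case: b vb => vb.
  by apply/asboolP; apply: filterS kU => n /vb.
apply/asboolPn => h; have [n [Un]] := filter_ex (filterI kU h).
by rewrite /= vb.
Qed.

(** This is what makes the coordinate of a node vanish on the sums of its own
    sequence. *)
Lemma Node_neq_child i l f n j : Node i l f <> f n j.
Proof.
suff main k : forall i l f n j, k = Node i l f -> k <> f n j.
  exact: (main _ i l f n j erefl).
elim: k => [//|i1 l1 f1 IH] i2 l2 f2 n2 j2 [_ _ <-] e.
by apply: (IH n2 j2 i1 l1 f1 n2 j2).
Qed.

Fixpoint subtree k (q : seq (nat * nat)) : tree :=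
  match k, q with
  | Node _ _ f, nj :: q' => subtree (f nj.1 nj.2) q'
  | _, _ => k
  end.

Lemma subtree0 k : subtree k [::] = k. Proof. by case: k. Qed.

Lemma subtree_rcons k q i l f nj : subtree k q = Node i l f ->
  subtree k (rcons q nj) = f nj.1 nj.2.
Proof.
elim: q k => [|mj q IH] [m|i' l' f'] //=; first by move=> [_ _ ->]; rewrite subtree0.
exact: IH.
Qed.

(** An enumeration of the subtrees of the members of [s] by their positions; the
    families [f n j] are followed for all [j], also beyond the size of the sum. *)
Definition subtrees (s : seq tree) (m : nat) : tree :=
  let: (i, q) := odflt (0%N, [::]) (unpickle m) in subtree (nth (Leaf 0) s i) q.

Lemma mem_subtrees s k : k \in s -> range (subtrees s) k.
Proof.
move=> ks; exists (pickle (index k s, [::] : seq (nat * nat))) => //.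
by rewrite /subtrees pickleK /= nth_index // subtree0.
Qed.

Lemma child_subtrees s i l f n j :
  range (subtrees s) (Node i l f) -> range (subtrees s) (f n j).
Proof.
move=> [m _]; rewrite /subtrees; case: (odflt _ _) => r q /subtree_rcons e.
by exists (pickle (r, rcons q (n, j))) => //; rewrite pickleK /= e.
Qed.

(** The difference between the node [k] and the [n]-th sum of its sequence: a
    character for which [k] is the limit must kill it for most [n]. *)
Definition relation k n : tree -> bool :=
  if k is Node _ l f then
    if admissible l f then unit_vector k + formal (terms l f n) else 0
  else 0.

(** The coordinate at the node itself shows that a relation has an even number of
    terms; the node then cancels, leaving a relation between the sums of an
    admissible sequence. *)
Lemma relation_independent i l f : admissible l f ->
  independent (relation (Node i l f)) setT.
Proof.
move=> adm N c _; rewrite /relation adm => e.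
have split_sum : subsum (fun n => unit_vector (Node i l f) + formal (terms l f n)) N c =
    subsum (fun=> unit_vector (Node i l f)) N c + subsum (fun n => formal (terms l f n)) N c.
  by rewrite /subsum -big_split; apply: eq_bigr => n _; rewrite mulrnDl.
rewrite split_sum in e.
have f0 : subsum (fun n => formal (terms l f n)) N c (Node i l f) = false.
  rewrite /subsum fct_sumE big1 // => n _; case: (c n) => //; rewrite mulr1n formalE.
  rewrite (_ : count_mem _ _ = 0%N) //; apply/count_memPn/negP => /mapP[j _].
  exact: Node_neq_child.
have cst : subsum (fun=> unit_vector (Node i l f)) N c =
    unit_vector (Node i l f) *+ odd (\sum_(n < N) c n)%N.
  by rewrite /subsum -boolean_mulrn ?sumrMnr //; exact: boolean_fun.
have odd0 : odd (\sum_(n < N) c n)%N = false.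
  have := congr1 (fun u : tree -> bool => u (Node i l f)) e.
  rewrite cst [LHS]/(_ + _) [LHS]/= f0; case: odd => //.
  by rewrite /unit_vector /= mulr1n eqxx.
move/asboolP: adm; apply => //.
by rewrite cst odd0 mulr0n add0r in e.
Qed.

Lemma sub_in_count (T : eqType) (P Q : pred T) (s : seq T) :
  {in s, subpred P Q} -> (count P s <= count Q s)%N.
Proof.
move=> PQ; rewrite (@eq_in_count _ P (predI P (mem s))); last first.
  by move=> x xs /=; rewrite xs andbT.
by apply: sub_count => x /andP[Px xs]; exact: PQ.
Qed.

(** With [phi] the restriction to trees of a character [psi] that kills the fresh
    relations but not [formal s], an induction shows that [value phi] agrees with
    [psi] on all the subtrees of [s]: at a node, [psi] of the [n]-th sum is [psi]
    of the node for all [n] in a set of its ultrafilter. *)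
Lemma separation s : formal s <> 0 -> exists phi, \sum_(k <- s) value phi k = true.
Proof.
move=> s0; have [own ownP] := exists_owner (subtrees s).
pose g j := relation (own (block_of j)) j.
have V2 := @boolean_fun tree.
have [psi [psiD psig psis]] := character_of_fresh V2 g s0.
have psi0 : psi 0 = false by have := psiD 0 0; rewrite addr0; case: (psi 0).
have psi_sum t : psi (formal t) = \sum_(k <- t) psi (unit_vector k).
  exact: (big_morph psi psiD psi0).
exists (psi \o unit_vector); rewrite -[RHS]psis psi_sum; apply: eq_big_seq => k ks.
suff valueE : range (subtrees s) k -> value (psi \o unit_vector) k = psi (unit_vector k).
  by apply: valueE; exact: mem_subtrees.
elim: k {ks} => // i l f IH kD /=; case: ifPn => // adm.
have [N NP] := ownP _ kD; set k := Node i l f in kD NP *.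
apply: (@ultra_limit_unique _ [set j | fresh (formal s) g j /\ own (block_of j) = k]).
  apply: (@ultra_slack _ 1 N) => n Nn kn; rewrite mul1n.
  apply: leq_trans (count_stale V2 (formal s) (g := g) (M := start n.+1) _).
    apply: sub_in_count => j; rewrite mem_index_iota => jn /=; apply: contra => fj.
    by apply/asboolP; split=> //; rewrite (block_ofE jn) NP.
  move=> M c cI e.
  have indep := @relation_independent i l f adm.
  apply: (indep M c) => //; rewrite -e /subsum; apply: eq_bigr => j _.
  case cj: (c j) => //; congr (_ *+ _).
  by rewrite /g (block_ofE (cI _ cj)) NP.
move=> j [/psig + ownj]; rewrite /g ownj /k /relation adm psiD psi_sum.
rewrite big_terms => /(boolean_eq addbb _ _).1 ->.
by apply: eq_bigr => m _; apply: IH; exact: child_subtrees kD.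
Qed.

(** * The two groups *)

Definition evaluation (s : seq tree) : (tree -> bool) -> bool :=
  \sum_(k <- s) value^~ k.

Lemma evaluationE s phi : evaluation s phi = \sum_(k <- s) value phi k.
Proof. by rewrite /evaluation fct_sumE. Qed.

Lemma evaluation_cat s t : evaluation (s ++ t) = evaluation s + evaluation t.
Proof. exact: big_cat. Qed.

(** By separation, the trees are linearly independent as functions of [phi]. *)
Lemma evaluation_formal s t : evaluation s = evaluation t -> formal s = formal t.
Proof.
have V2 := @boolean_fun tree; have W2 := @boolean_fun (tree -> bool).
move=> /(boolean_eq W2) st; apply/(boolean_eq V2).
have {st} := st; rewrite -evaluation_cat /formal -big_cat -/(formal _) => st.
apply: contrapT => /separation[phi]; by rewrite -evaluationE st.
Qed.

Fixpoint colored i k : Prop :=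
  if k is Node i' _ f then i' = i /\ forall n j, colored i (f n j) else True.

Definition colored_span i : set ((tree -> bool) -> bool) :=
  evaluation @` [set s | forall k, k \in s -> colored i k].

Record colored_group i := ColoredGroup {
  functional :> (tree -> bool) -> bool;
  functionalP : colored_span i functional }.

Lemma functional_inj i : injective (@functional i).
Proof.
move=> [x xP] [y yP] /= e; move: xP yP; rewrite e => xP yP.
by congr ColoredGroup; exact: Prop_irrelevance.
Qed.

HB.instance Definition _ i := gen_eqMixin (colored_group i).
HB.instance Definition _ i := gen_choiceMixin (colored_group i).

Lemma colored_span0 i : colored_span i 0.
Proof. by exists [::] => //; rewrite /evaluation big_nil. Qed.

Lemma colored_spanD i x y :
  colored_span i x -> colored_span i y -> colored_span i (x + y).
Proof.
move=> [s sP <-] [t tP <-]; exists (s ++ t); last exact: evaluation_cat.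
by move=> k; rewrite mem_cat => /orP[/sP|/tP].
Qed.

Section ColoredGroup.
Context {i : bool}.
Implicit Types x y z : colored_group i.

Definition cg_one : colored_group i := ColoredGroup (colored_span0 i).

Definition cg_mul x y := ColoredGroup (colored_spanD (functionalP x) (functionalP y)).

Fact cg_mulA : associative cg_mul.
Proof. by move=> x y z; apply: functional_inj; exact: addrA. Qed.

Fact cg_mul1 : left_id cg_one cg_mul.
Proof. by move=> x; apply: functional_inj; exact: add0r. Qed.

Fact cg_mulx1 : right_id cg_one cg_mul.
Proof. by move=> x; apply: functional_inj; exact: addr0. Qed.

Fact cg_mulxx : forall x, cg_mul x x = cg_one.
Proof. by move=> x; apply: functional_inj; exact: boolean_fun. Qed.

HB.instance Definition _ :=
  isGroup.Build (colored_group i) cg_mulA cg_mul1 cg_mulx1 cg_mulxx cg_mulxx.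

(** The topology of pointwise convergence, induced from [(tree -> bool) -> bool] with
    [bool] discrete. *)
Definition cg_nbhs x : set_system (colored_group i) :=
  [set U | exists2 L : set (tree -> bool), finite_set L &
    forall y, (forall phi, L phi -> y phi = x phi) -> U y].

HB.instance Definition _ := hasNbhs.Build (colored_group i) cg_nbhs.

Fact cg_nbhs_filter x : ProperFilter (nbhs x).
Proof.
constructor; last constructor.
- by move=> [L _ /(_ x)]; apply.
- by exists set0.
- move=> U W [L Lfin LU] [M Mfin MW]; exists (L `|` M); first by rewrite finite_setU.
  by move=> y yx; split; [apply: LU | apply: MW] => phi ?; apply: yx; [left|right].
- by move=> U W UW [L Lfin LU]; exists L => // y /LU/UW.
Qed.

Fact cg_nbhs_singleton x (U : set (colored_group i)) : nbhs x U -> U x.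
Proof. by move=> [L _]; apply. Qed.

Fact cg_nbhs_nbhs x (U : set (colored_group i)) : nbhs x U -> nbhs x (nbhs^~ U).
Proof.
move=> [L Lfin LU]; exists L => // y yx; exists L => // z zy.
by apply: LU => phi Lphi; rewrite zy // yx.
Qed.

HB.instance Definition _ := Nbhs_isNbhsTopological.Build (colored_group i)
  cg_nbhs_filter cg_nbhs_singleton cg_nbhs_nbhs.

Fact cg_mul_continuous :
  continuous (fun x : colored_group i * colored_group i => (x.1 * x.2)%g).
Proof.
move=> [x y] U [L Lfin LU].
exists ([set x' : colored_group i | forall phi, L phi -> x' phi = x phi],
        [set y' : colored_group i | forall phi, L phi -> y' phi = y phi]) => /=.
  by split; exists L.
move=> [x' y'] [/= x'x y'y]; apply: LU => phi Lphi.
by rewrite [LHS]/(x' phi + y' phi) x'x // y'y.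
Qed.

Fact cg_inv_continuous : continuous (fun x : colored_group i => (x^-1)%g).
Proof. by move=> x U. Qed.

HB.instance Definition _ := PreTopologicalGroup_isTopologicalGroup.Build
  (colored_group i) cg_mul_continuous cg_inv_continuous.

Lemma nbhs_agree x phi : nbhs x [set y | y phi = x phi].
Proof. by exists [set phi] => // y; apply. Qed.

Lemma colored_group_hausdorff : hausdorff_space (colored_group i).
Proof.
move=> x y xy; apply: functional_inj; apply/funext => phi.
by have [z [/= <- <-]] := xy _ _ (nbhs_agree x phi) (nbhs_agree y phi).
Qed.

Fact leaf_functionalP n : colored_span i (evaluation [:: Leaf n]).
Proof. by exists [:: Leaf n] => // k; rewrite inE => /eqP ->. Qed.

Definition leaf_functional n := ColoredGroup (leaf_functionalP n).

Lemma leaf_functionalE n phi : leaf_functional n phi = phi (Leaf n).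
Proof. by rewrite [LHS]evaluationE big_seq1. Qed.

Lemma leaf_functional_inj : injective leaf_functional.
Proof.
move=> n m nm; have := congr1 (fun x => functional x (fun k => `[< k = Leaf m >])) nm.
by rewrite !leaf_functionalE (asboolT (erefl (Leaf m))) => /asboolP[].
Qed.

Lemma colored_group_infinite : infinite_set [set: colored_group i].
Proof.
move=> fin; apply: infinite_nat.
rewrite -(preimage_setT leaf_functional); apply: finite_preimage fin.
by move=> n m _ _; exact: leaf_functional_inj.
Qed.

(** An infinite set contains a linearly independent sequence, whose formal
    representatives are independent as well; the node of colour [i] built on them
    is a limit along an ultrafilter containing the cofinite sets, hence an
    accumulation point. *)
Lemma colored_group_countably_compact : countably_compact (colored_group i).
Proof.
move=> X Xinf; have W2 := @boolean_fun (tree -> bool).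
have imXinf : infinite_set ([set functional x | x in X]).
  move=> fin; apply: Xinf.
  apply: (@sub_finite_set _ _ (@functional i @^-1` [set functional x | x in X])).
    by move=> x Xx; exists x.
  by apply: finite_preimage fin => x y _ _; exact: functional_inj.
have [v vX vindep] := infinite_independent W2 imXinf.
have xE n : exists y : colored_group i, X y /\ functional y = v n.
  by have [y Xy yv] := vX n; exists y.
have [x xP] := boolp.choice xE.
have sE n : exists t, (forall k, k \in t -> colored i k) /\ evaluation t = v n.
  by have [t tP tv] := functionalP (x n); exists t; rewrite tv; case: (xP n).
have [s sP] := boolp.choice sE.
pose l n := size (s n); pose f n := nth (Leaf 0) (s n).
have termsE : terms l f = s by apply/funext => n; exact: mkseq_nth.
have adm : admissible l f.
  apply/asboolP; rewrite termsE => N c _ e; apply: (vindep N c) => //.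
  pose t := flatten [seq if c n then s n else [::] | n <- iota 0 N].
  have sum_t (V : zmodType) (y : tree -> V) :
      \sum_(k <- t) y k = subsum (fun n => \sum_(k <- s n) y k) N c.
    rewrite big_flatten big_map -{1}[N]subn0 -/(index_iota 0 N) big_mkord.
    by apply: eq_bigr => n _; case: (c n); rewrite ?mulr1n ?big_nil.
  have <- : evaluation t = subsum v N c.
    by rewrite [LHS]sum_t; apply: eq_bigr => n _; case: (sP n) => _ <-.
  by apply: sum_formal => //; rewrite [LHS]sum_t.
pose k := Node i l f.
have kP : colored_span i (evaluation [:: k]).
  exists [:: k] => // k'; rewrite inE => /eqP -> /=; split=> // n j.
  (* Beyond its size, each finite set is padded with a leaf. *)
  have [js|js] := ltnP j (size (s n)); last by rewrite /f nth_default.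
  by have [+ _] := sP n; apply; exact: mem_nth.
exists (ColoredGroup kP) => U [L Lfin LU].
have {Lfin}/finite_fsetP[D LD] := Lfin.
have ultraU : ultra k [set n | U (x n)].
  have : ultra k (\bigcap_(phi in L) [set n | x n phi = value phi k]).
    rewrite LD; apply: filter_bigI => phi _; apply: filterS (value_limit phi i adm) => n /= <-.
    by rewrite (xP n).2 -(sP n).2 evaluationE termsE.
  apply: filterS => n Dn; apply: LU => phi /Dn /= ->.
  by rewrite [RHS]evaluationE big_seq1.
have [M xM] : exists M, forall n, (M <= n)%N -> x n <> ColoredGroup kP.
  have [[m xm]|no] := pselect (exists m, x m = ColoredGroup kP); last first.
    by exists 0%N => n _ xn; apply: no; exists n.
  exists m.+1 => n mn xn; suff nm : n = m by rewrite nm ltnn in mn.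
  apply: (independent_inj W2 vindep).
  by rewrite -(xP n).2 -(xP m).2 xm xn.
have [n [Un Mn]] := filter_ex (filterI ultraU (ultra_cofinite k M)).
by exists (x n); split=> //; [apply/eqP; exact: xM | exact: (xP n).1].
Qed.

End ColoredGroup.

(** * The product *)

Lemma bicolored_leaf k : colored false k -> colored true k -> exists n, Leaf n = k.
Proof. by case: k => [n _ _|i l f [-> _] []//]; exists n. Qed.

(** By the independence of the trees, an element of both groups is a sum of trees
    of both colours at once, hence of leaves. *)
Lemma bicolored_functional (x : colored_group false) (y : colored_group true) :
  functional x = functional y ->
  exists2 F : seq nat, uniq F & functional x = evaluation (map Leaf F).
Proof.
have [s sP <-] := functionalP x; have [t tP <-] := functionalP y => /evaluation_formal st.
pose r := [seq k <- undup s | formal s k].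
have runiq : uniq r by rewrite filter_uniq // undup_uniq.
have [F rF] : exists F, r = map Leaf F.
  have : forall k, k \in r -> exists n, Leaf n = k.
    move=> k; rewrite mem_filter mem_undup => /andP[sk ks].
    apply: bicolored_leaf; first exact: sP.
    apply: tP; move: sk; rewrite st formalE -has_pred1 has_count.
    by case: (count_mem k t).
  elim: r {runiq} => [|k r IH] rP; first by exists [::].
  have [n nk] := rP k (mem_head _ _).
  have [|F rF] := IH; first by move=> j jr; apply: rP; rewrite inE jr orbT.
  by exists (n :: F); rewrite /= nk rF.
exists F; first by move: runiq; rewrite rF; exact: map_uniq.
rewrite -rF; apply/(boolean_eq (@boolean_fun (tree -> bool))).
rewrite -evaluation_cat; apply: sum_formal; first exact: boolean_fun.
apply/funext => k; rewrite formalE count_cat oddD -formalE (count_uniq_mem _ runiq).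
rewrite mem_filter mem_undup; case sk: (formal s k) => //.
by move: sk; rewrite formalE -has_pred1 has_count; case: (count_mem k s).
Qed.

Theorem mainTheorem2 :
  exists G0 G1 : topologicalGroupType,
    [/\ hausdorff_space G0, infinite_set [set: G0] & countably_compact G0] /\
    [/\ hausdorff_space G1, infinite_set [set: G1] & countably_compact G1] /\
    ~ countably_compact (G0 * G1)%type.
Proof.
exists (colored_group false), (colored_group true).
split; [|split]; try by split; [exact: colored_group_hausdorff |
  exact: colored_group_infinite | exact: colored_group_countably_compact].
pose diag n : colored_group false * colored_group true :=
  (leaf_functional n, leaf_functional n).
have diag_inj : injective diag by move=> n m /(congr1 fst)/leaf_functional_inj.
move=> /(_ (range diag)) [|[x y] xyP].
  move=> fin; apply: infinite_nat.
  apply: (@sub_finite_set _ _ (diag @^-1` range diag)); first by move=> n _; exists n.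
  by apply: finite_preimage fin => n m _ _; exact: diag_inj.
(* The neighbourhoods of [(x, y)] contain diagonal points. *)
have xy : functional x = functional y.
  apply/funext => phi.
  have [|_ [_ [n _ <-] [xn yn]]] :=
      xyP ([set u | functional u phi = functional x phi] `*`
           [set v | functional v phi = functional y phi]).
    exists ([set u | functional u phi = functional x phi],
            [set v | functional v phi = functional y phi]) => //=.
    by split; exact: nbhs_agree.
  by rewrite -[LHS]xn -[RHS]yn [LHS]leaf_functionalE [RHS]leaf_functionalE.
have [F Funiq xF] := bicolored_functional xy.
have xE phi : functional x phi = \sum_(n <- F) phi (Leaf n).
  by rewrite xF evaluationE big_map.
(* [outside] vanishes at [x] and excludes [n] outside [F]; the indicator of a leaf
   [n] of [F] is nonzero at [x] and excludes all [m] other than [n]. *)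
pose outside (k : tree) := k \notin map Leaf F.
pose L : set (tree -> bool) := [set outside] `|` [set eq_op^~ (Leaf n) | n in [set` F]].
pose U : set (colored_group false) :=
  [set u | forall phi, L phi -> functional u phi = functional x phi].
have [|z [zxy [m _ mz] [mU _]]] := xyP (U `*` setT).
  exists (U, setT) => //; split; last exact: filterT.
  exists L => //; rewrite finite_setU; split; first exact: finite_set1.
  exact: finite_image.
move: zxy mU; rewrite -{z}mz => /eqP zxy mU; apply: zxy.
have mF : m \in F.
  have := mU outside (or_introl erefl); rewrite leaf_functionalE xE big_seq big1.
    by move/negbT/negPn; rewrite mem_map // => ? ? [].
  by move=> n nF; apply/negbTE/negPn/map_f.
have Fm n : n \in F -> n = m.
  move=> nF; have := mU (eq_op^~ (Leaf n)) (or_intror (ex_intro2 _ _ n nF erefl)).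
  rewrite leaf_functionalE xE (bigD1_seq n) //= big1 => [|j jn].
    by rewrite addr0 eqxx => /eqP[].
  by apply/negbTE/eqP => -[ejn]; rewrite ejn eqxx in jn.
have FE : F = [:: m].
  case: F Funiq mF Fm {xF xE outside L U mU} => [//|a [|b F]] /=.
    by move=> _ _ /(_ a (mem_head _ _)) ->.
  rewrite inE negb_or => /andP[/andP[/eqP ab _] _] _ Fm; exfalso; apply: ab.
  by rewrite (Fm a) ?inE ?eqxx // (Fm b) // !inE eqxx orbT.
by congr (_, _); apply: functional_inj; rewrite -?xy xF FE.
Qed.
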